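(* Let $\mathcal{O}\subseteq\mathbb{R}^n$ be open, let $S$ be a relatively closed subset of $\mathcal{O}$, and let $A$ be a compact subset of a Euclidean space. Let $F:\mathcal{O}\times A\rightrightarrows\mathbb{R}^n$ be given by $$F(x,a)=\prod_{i=1}^n g_i(x,a)D_i(x),\qquad x\in\mathcal{O},\ a\in A,$$ where each $g_i:\mathcal{O}\times A\to\mathbb{R}$ is locally Lipschitz and each $D_i:\mathbb{R}^n\rightrightarrows\mathbb{R}$ is a measurable, locally bounded, closed valued, convex valued, lower semicontinuous multifunction such that $0\in D_i(x)$ for all $x\in\mathbb{R}^n$ and $x\mapsto\mathrm{cone}\{D_i(x)\}$ is constant. Then $(F,S)$ is strongly invariant if and only if $F(x,A)\subseteq T^B_S(x)$ for all $x\in S$.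
   Context: $\|\cdot\|$ is the supremum norm and $\mathcal{B}_n$ the closed unit ball of $\mathbb{R}^n$ for it. All multifunctions are nonempty valued. For $S_i\subseteq\mathbb{R}$, $\prod_{i=1}^nS_i=S_1\times\cdots\times S_n$; $g_i(x,a)D_i(x)=\{g_i(x,a)\delta:\delta\in D_i(x)\}$; $F(x,A)=\bigcup_{a\in A}F(x,a)$. For $P$ in a Euclidean space, $\mathrm{cone}\{P\}=\{\eta p:\eta\ge 0,\ p\in P\}$. A multifunction $D$ on $\mathbb{R}^n$ is locally bounded if $D(\eta\mathcal{B}_n)$ is bounded for each $\eta>0$; it is lower semicontinuous if for each $x$ and $\varepsilon>0$ there is $\delta>0$ such that $D(x)\subseteq D(x')+\varepsilon\mathcal{B}$ for all $x'\in x+\delta\mathcal{B}_n$, where $\mathcal{B}$ is the closed unit ball of the target space. Measurable means Borel measurable if $n>1$ and Lebesgue measurable if $n=1$. Trajectories of $F$ are the absolutely continuous functions $y:[0,T]\to\mathcal{O}$, $T>0$, for which there is a measurable $\alpha:[0,T]\to A$ with $\dot y(t)\in F(y(t),\alpha(t))$ for almost all $t\in[0,T]$. $(F,S)$ is strongly invariant if for each $T>0$, every trajectory $y:[0,T]\to\mathcal{O}$ of $F$ with $y(0)\in S$ satisfies $y(t)\in S$ for all $t\in[0,T]$. Bouligand (contingent) tangent cone: for $x\in S$, $T^B_S(x)$ is the set of $q\in\mathbb{R}^n$ for which there exist $t_i>0$ with $t_i\downarrow 0$ and $x_i\in S$ with $x_i\to x$ such that $(x_i-x)/t_i\to q$.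 *)

(* Defs.v *)
From HB Require Import structures.
From mathcomp Require Import all_boot all_order all_algebra.
From mathcomp Require Import all_classical all_reals all_analysis.
From mathcomp Require Import measurable_realfun.

Set Implicit Arguments.
Unset Strict Implicit.
Unset Printing Implicit Defensive.

Import Order.TTheory GRing.Theory Num.Theory.
Import numFieldNormedType.Exports.

Local Open Scope classical_set_scope.
Local Open Scope ring_scope.

(* MathComp-Analysis.  R^n is 'rV[R]_n; its library norm is the supremum norm.
   A multifunction from X to Y is a function X -> set Y. *)

Section SetsAndMultifunctions.
Context {R : realType}.

Definition cball {V : normedModType R} (r : R) : set V :=
  [set v | `|v| <= r].

Definition cone {V : lmodType R} (P : set V) : set V :=
  [set eta *: p | eta in [set eta : R | 0 <= eta] & p in P].

Definition prod_set {n : nat} (S : 'I_n -> set R) : set 'rV[R]_n :=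
  [set v | forall i, S i (v ord0 i)].

Definition relatively_closed {T : topologicalType} (O S : set T) : Prop :=
  exists2 C : set T, closed C & S = C `&` O.

Definition locally_lipschitz_on {V W : normedModType R} (A : set V)
    (f : V -> W) : Prop :=
  forall p, A p -> exists2 U, nbhs p U & [lipschitz f q | q in A `&` U].

Definition locally_bounded_multifunction {V W : normedModType R}
    (D : V -> set W) : Prop :=
  forall eta : R, 0 < eta -> bounded_set (\bigcup_(x in cball eta) D x).

Definition lsc_multifunction {V W : normedModType R} (D : V -> set W)
    : Prop :=
  forall (x : V) (eps : R), 0 < eps ->
    exists2 delta : R, 0 < delta &
      forall x' : V, cball delta (x' - x) ->
        D x `<=` [set u + w | u in D x' & w in cball eps].

(* [lebesgue_measure] is the Lebesgue measure on the Borel sets; its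
   negligible sets are the subsets of Borel sets of measure zero. *)
Definition lebesgue_measurable : set (set R) :=
  completed_algebra_gen (@lebesgue_measure R).

(* [const_mx] is the identification of R with R^1 when n = 1. *)
Definition measurable_rV {n : nat} (E : set 'rV[R]_n) : Prop :=
  if n == 1%N then lebesgue_measurable [set t : R | E (const_mx t)]
  else (<<s [set U : set 'rV[R]_n | open U] >>) E.

Definition measurable_multifunction {n : nat} {W : topologicalType}
    (D : 'rV[R]_n -> set W) : Prop :=
  forall U : set W, open U -> measurable_rV [set x | D x `&` U !=set0].

Definition bouligand_cone {n : nat} (S : set 'rV[R]_n) (x : 'rV[R]_n)
    : set 'rV[R]_n :=
  [set q | exists (t : nat -> R) (z : nat -> 'rV[R]_n),
    [/\ forall i, 0 < t i,
        nonincreasing_seq t /\ t @ \oo --> (0 : R),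
        forall i, S (z i),
        z @ \oo --> x &
        (fun i => (t i)^-1 *: (z i - x)) @ \oo --> q]].

End SetsAndMultifunctions.

Section Trajectories.
Context {R : realType}.

(* A degenerate interval has an empty interior, so the disjointness condition
   allows adjacent and degenerate intervals [a k, b k]. *)
Definition absolutely_continuous {V : normedModType R} (T : R) (y : R -> V)
    : Prop :=
  forall eps : R, 0 < eps -> exists2 delta : R, 0 < delta &
    forall (N : nat) (a b : 'I_N -> R),
      (forall k, [/\ 0 <= a k, a k <= b k & b k <= T]) ->
      trivIset setT (fun k => `]a k, b k[%classic) ->
      \sum_(k < N) (b k - a k) < delta ->
      \sum_(k < N) `|y (b k) - y (a k)| < eps.

Definition measurable_control {m : nat} (A : set 'rV[R]_m) (T : R)
    (alpha : R -> 'rV[R]_m) : Prop :=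
  (forall t : R, t \in `[0, T] -> A (alpha t)) /\
  (forall U : set 'rV[R]_m, open U ->
    lebesgue_measurable (`[0, T]%classic `&` alpha @^-1` U)).

(* Functions on [0, T] are represented by functions on R of which only the
   values on [0, T] are constrained.  At a point of the open interval ]0, T[,
   derivability depends on these values only; 0 and T form a null set. *)
Definition trajectory {n m : nat} (O : set 'rV[R]_n) (A : set 'rV[R]_m)
    (F : 'rV[R]_n -> 'rV[R]_m -> set 'rV[R]_n) (T : R) (y : R -> 'rV[R]_n)
    : Prop :=
  [/\ forall t : R, t \in `[0, T] -> O (y t),
      absolutely_continuous T y &
      exists2 alpha : R -> 'rV[R]_m, measurable_control A T alpha &
        {ae @lebesgue_measure R, forall t : R, t \in `[0, T] ->
          derivable y t 1 /\ F (y t) (alpha t) ('D_1 y t)}].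

Definition strongly_invariant {n m : nat} (O : set 'rV[R]_n)
    (A : set 'rV[R]_m) (F : 'rV[R]_n -> 'rV[R]_m -> set 'rV[R]_n)
    (S : set 'rV[R]_n) : Prop :=
  forall T : R, 0 < T -> forall y : R -> 'rV[R]_n,
    trajectory O A F T y -> S (y 0) -> forall t : R, t \in `[0, T] -> S (y t).

End Trajectories.

(* Main.v *)
Require Import Defs.
From mathcomp Require Import all_boot all_order all_algebra.
From mathcomp Require Import all_classical all_reals all_analysis.
From mathcomp Require Import measurable_realfun ring lra.
Import Order.TTheory GRing.Theory Num.Theory.
Import numFieldNormedType.Exports.
Local Open Scope classical_set_scope.
Local Open Scope ring_scope.

(* If v is in F(x,a), lower semicontinuity, convexity and 0 in D_i give
   v/2 in F(z,a) for z near x, so the segment x + t v/2 is a trajectory with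
   constant control a; by invariance it lies in S, and v is tangent to S at x.

   Conversely, let g_i(y,a) d_i be the components of the velocity of a
   trajectory y at time t.  Since cone D_i is constant, a small positive
   multiple of q = (g_i(s,a) d_i)_i belongs to F(s,a) for every s in S, so q is
   tangent to S at s although d_i need not belong to D_i(s).  Taking for s a
   point of S nearest to y, the Lipschitz bound on g gives
   |y' - q| <= c |y - s|; hence the distance from y to S increases by at most
   (c dist + eps) h along arbitrarily small h > 0, for almost every t.  This
   one-sided information suffices for an absolutely continuous function, and a
   Gronwall argument keeps y in S. *)

(** * Absolute continuity and increments up to a null set *)

Lemma trivIset_pairwise_itv {R : realType} (s : seq (R * R)) :
  pairwise (fun p q => p.2 <= q.1) s ->
  trivIset setT (fun k : 'I_(size s) =>
    `](tnth (in_tuple s) k).1, (tnth (in_tuple s) k).2[%classic).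
Proof.
move=> /(pairwiseP (0, 0)) s_pw.
have ltk (i j : 'I_(size s)) (t : R) : (i < j)%N ->
    t \in `](tnth (in_tuple s) i).1, (tnth (in_tuple s) i).2[ ->
    t \in `](tnth (in_tuple s) j).1, (tnth (in_tuple s) j).2[ -> False.
  move=> ij; rewrite !in_itv/= => /andP[_ ti] /andP[tj _].
  have := s_pw i j (ltn_ord i) (ltn_ord j) ij.
  rewrite !(tnth_nth (0, 0)) /= in ti tj *.
  by move=> /(lt_le_trans ti) /(lt_trans tj); rewrite ltxx.
move=> i j _ _ [t [/= ti tj]]; apply/val_inj.
by case: (ltngtP i j) => // ij; exfalso;
  [exact: ltk ij ti tj|exact: ltk ij tj ti].
Qed.

(** Successive intervals whose interiors lie in [U] have total length at most the measure of [U], so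
    absolute continuity applies to them. *)
Lemma absolutely_continuous_open {R : realType} {V : normedModType R} {T : R}
    {y : R -> V} (eps : R) :
  absolutely_continuous T y -> 0 < eps ->
  exists2 delta : R, 0 < delta &
    forall (U : set R) (s : seq (R * R)), open U ->
      (lebesgue_measure U < delta%:E)%E ->
      (forall p, p \in s -> [/\ 0 <= p.1, p.1 <= p.2, p.2 <= T &
        `]p.1, p.2[%classic `<=` U]) ->
      pairwise (fun p q => p.2 <= q.1) s ->
      \sum_(p <- s) `|y p.2 - y p.1| < eps.
Proof.
move=> y_ac /y_ac[delta delta_gt0 ac].
exists delta => // U s Uopen Udelta sU s_pw.
have mem k : tnth (in_tuple s) k \in s by exact: mem_tnth.
rewrite big_tnth; apply: ac => [k||].
- by have [] := sU _ (mem k).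
- exact: trivIset_pairwise_itv.
rewrite -lte_fin; apply: le_lt_trans Udelta.
rewrite -sumEFin.
under eq_bigr => k _.
  have [_ le12 _ _] := sU _ (mem k).
  have -> : ((tnth (in_tuple s) k).2 - (tnth (in_tuple s) k).1)%:E =
    lebesgue_measure
      `](tnth (in_tuple s) k).1, (tnth (in_tuple s) k).2[%classic.
    rewrite lebesgue_measure_itv/= lte_fin -EFinB; case: ltP => // le21.
    by congr EFin; apply/eqP; rewrite subr_eq0 eq_le le12 le21.
  over.
rewrite -measure_bigsetU_ord //; last exact: trivIset_pairwise_itv.
apply: le_measure; rewrite ?inE.
- by apply: bigsetU_measurable => k _; exact: measurable_itv.
- exact: open_measurable.
- apply: (big_ind (fun E => E `<=` U)) => [//|E1 E2 E1U E2U|k _].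
    by rewrite subUset.
  by have [] := sU _ (mem k).
Qed.

Lemma absolutely_continuous_uniform {R : realType} {V : normedModType R} {T : R}
    {y : R -> V} (eps : R) : absolutely_continuous T y -> 0 < eps ->
  exists2 delta : R, 0 < delta & forall s t : R,
    0 <= s -> s <= t -> t <= T -> t - s < delta -> `|y t - y s| < eps.
Proof.
move=> y_ac /y_ac[delta delta_gt0 ac]; exists delta => // s t s_ge0 st tT ts.
have := ac 1%N (fun=> s) (fun=> t).
rewrite !big_ord1; apply => //.
by move=> i j _ _ _; rewrite !ord1.
Qed.

(* Cover N by an open set U so small that phi varies by less than e on disjoint
   intervals inside U.  Starting from a, advance by the given steps off N and
   by steps inside U at the points of N; the total variation of the latter is
   less than e.  [reach] is the set of the times attained in this way; the slack
   eta makes it stable under suprema. *)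
Lemma absolutely_continuous_increment_le {R : realType} (T a b c : R)
    (phi : R -> R) (N : set R) :
  absolutely_continuous T phi -> (@lebesgue_measure R).-negligible N ->
  0 <= c -> 0 <= a -> a <= b -> b <= T ->
  (forall t, a <= t -> t < b -> ~ N t ->
    exists h, [/\ 0 < h, t + h <= b & phi (t + h) - phi t <= c * h]) ->
  phi b - phi a <= c * (b - a).
Proof.
move=> phi_ac N0 c_ge0 a_ge0 ab bT step; apply/ler_addgt0Pr => e e_gt0.
have [delta delta_gt0 ac] := absolutely_continuous_open _ phi_ac e_gt0.
have [U [Uopen NU muU]] : exists U, [/\ open U, N `<=` U &
    (lebesgue_measure U < delta%:E)%E].
  move/negligible_outer_measure : N0 => N0.
  have d2 : 0 < delta / 2 by rewrite divr_gt0.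
  have [U [Uo NU]] := outer_measure_open_le N d2.
  rewrite N0 add0e => UU; exists U; split => //.
  by apply: le_lt_trans UU _; rewrite lte_fin; lra.
pose covered t s := [/\ forall p, p \in s ->
    [/\ a <= p.1, p.1 <= p.2, p.2 <= t & `]p.1, p.2[%classic `<=` U] &
    pairwise (fun p q => p.2 <= q.1) s].
pose reach t := [/\ a <= t, t <= b & forall eta, 0 < eta ->
  exists2 s, covered t s &
    phi t - phi a <= c * (t - a) + \sum_(p <- s) `|phi p.2 - phi p.1| + eta].
have reach_b : reach b -> phi b - phi a <= c * (b - a) + e.
  move=> [_ _ b_reach]; apply/ler_addgt0Pr => eta /b_reach[s [sU s_pw]].
  move/le_trans; apply; rewrite lerD2r lerD2l ltW// (ac U)// => p /sU[? ? ? ?].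
  by split => //; [exact: le_trans a_ge0 _|exact: le_trans bT].
have ub_b : ubound [set t | reach t] b by move=> t [].
have reach_a : reach a.
  split => // eta eta_gt0; exists [::]; first by split.
  by rewrite big_nil !subrr mulr0 !add0r ltW.
have reach_sup : has_sup [set t | reach t] by split; [exists a|exists b].
pose t := sup [set t | reach t].
have at_ : a <= t by by apply: ub_le_sup; first by exists b.
have tb : t <= b by apply: ge_sup => //; exists a.
have reach_t : reach t.
  split => // eta eta_gt0.
  (* One half of [eta] is the slack at an attained time [r] close to [t], the other half bounds the
     increment of [phi] from [r] to [t]. *)
  have e2 : 0 < eta / 2 by rewrite divr_gt0.
  have [d d_gt0 phi_cont] := absolutely_continuous_uniform _ phi_ac e2.
  have [r [ar rb rr] tr] := sup_adherent d_gt0 reach_sup.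
  have rt : r <= t by apply: ub_le_sup; [exists b|split].
  have [s [sU s_pw] phir] := rr _ e2.
  exists s.
    by split => // p /sU[? ? pr ?]; split => //; exact: le_trans rt.
  have : `|phi t - phi r| < eta / 2.
    apply: phi_cont => //; [exact: le_trans ar|exact: le_trans bT|].
    by rewrite ltrBlDr -ltrBlDl.
  move=> /ltr_normlW phit.
  have : c * (r - a) <= c * (t - a) by rewrite ler_wpM2l// lerD2r.
  lra.
apply: reach_b; suff <- : t = b by [].
apply/eqP; rewrite eq_le tb leNgt; apply/negP => tb'.
suff [h h_gt0 /(ub_le_sup (ex_intro _ b ub_b))] :
    exists2 h, 0 < h & reach (t + h).
  by rewrite -/t gerDl leNgt h_gt0.
have [Nt|/(step t at_ tb')[h [h_gt0 hb phih]]] := pselect (N t); last first.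
  exists h => //; split => //; first by rewrite (le_trans at_)// lerDl ltW.
  move=> eta eta_gt0; have [_ _ /(_ eta eta_gt0)[s [sU s_pw] phit]] := reach_t.
  exists s; last by lra.
  split => // p /sU[? ? pt ?]; split => //; apply: le_trans pt _.
  by rewrite lerDl ltW.
have /nbhs_ballP[r /= r_gt0] := open_nbhs_nbhs (conj Uopen (NU _ Nt)).
rewrite ball_itv => rU.
(* The first bound keeps []t, t + h[] in the ball around [t] contained in [U], the second keeps
   [t + h] at most [b]. *)
pose h := Num.min (r / 2) (b - t).
have h_gt0 : 0 < h by rewrite lt_min subr_gt0 tb' divr_gt0.
exists h => //; split; [by rewrite (le_trans at_)// lerDl ltW| |].
  by rewrite -lerBrDl ge_min lexx orbT.
move=> eta eta_gt0; have [_ _ /(_ eta eta_gt0)[s [sU s_pw] phit]] := reach_t.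
exists (rcons s (t, t + h)); last first.
  rewrite big_rcons/=.
  have := ler_norm (phi (t + h) - phi t).
  have := mulr_ge0 c_ge0 (ltW h_gt0).
  lra.
split; last first.
  rewrite pairwise_rcons s_pw andbT; apply/allP => p /sU[_ _ pt _].
  exact: pt.
move=> p; rewrite mem_rcons inE => /orP[/eqP ->/=|/sU[? ? pt ?]]; last first.
  by split => //; apply: le_trans pt _; rewrite lerDl ltW.
split => //; first by rewrite lerDl ltW.
apply: subset_trans rU => x /=; rewrite !in_itv/= => /andP[tx xh].
rewrite (lt_trans _ tx) ?ltrBlDr ?ltrDl//= (lt_trans xh)// ltrD2l.
by rewrite (@le_lt_trans _ _ (r / 2)) ?ge_min ?lexx//; lra.
Qed.

(** * Nearest points, convex sets and cones *)

Lemma nearest_point {R : realType} {n : nat} (K : set 'rV[R]_n) :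
  compact K -> K !=set0 ->
  exists p : 'rV[R]_n -> 'rV[R]_n,
    forall x, K (p x) /\ forall s, K s -> `|x - p x| <= `|x - s|.
Proof.
move=> K_compact K0; suff /choice[p ?] : forall x, exists p, K p /\
  forall s, K s -> `|x - p| <= `|x - s| by exists p.
move=> x.
have [|p pK pmin] := @EVT_min_rV _ _ (fun s => `|x - s|) K K0 K_compact.
  apply: continuous_subspaceT => s.
  exact: (cvg_norm (cvgB (cvg_cst _) cvg_id)).
exists p; split; first by rewrite inE in pK.
by move=> s Ks; apply: pmin; rewrite inE.
Qed.

Lemma row_norm_le {R : realType} {n : nat} (v : 'rV[R]_n) (e : R) :
  0 <= e -> (forall i, `|v ord0 i| <= e) -> `|v| <= e.
Proof.
move=> e_ge0 ve; rewrite [leLHS]/Num.norm/= mx_normrE.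
by apply: bigmax_le => // -[i j] _; rewrite (ord1 i).
Qed.

Lemma convex_set_scale {R : realType} (I : set R) (d l : R) :
  convex_set (I : set (convex_lmodType R^o)) -> I 0 -> I d ->
  0 <= l -> l <= 1 -> I (l * d).
Proof.
move=> I_convex I0 Id.
move=> l_ge0 l_le1.
have l01 : Itv.spec (@Itv.num_sem R) (Itv.Real `[0%Z, 1%Z]) l.
  by apply/and3P; split => //=; rewrite ?num_real// ?in_itv/= ?l_ge0.
have := I_convex d 0 (Itv.mk l01); rewrite !inE => /(_ Id I0).
rewrite -/(conv (Itv.mk l01) (d : R^o) (0 : R^o)) convRE /=.
by rewrite mulr0 addr0.
Qed.

(** If [d = eta * p] with [p] in [I], then [l * d] lies between 0 and [p] as soon as [l * eta <= 1].
    The bound [(eta + 1)^-1] on [l] also covers [eta = 0]. *)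
Lemma cone_scale {R : realType} (I : set R) (d : R) :
  convex_set (I : set (convex_lmodType R^o)) -> I 0 -> cone (I : set R^o) d ->
  exists2 l0, 0 < l0 & forall l, 0 <= l -> l <= l0 -> I (l * d).
Proof.
move=> I_convex I0 [eta eta_ge0 [p Ip <-]].
have e1 : 0 < eta + 1 by rewrite ltr_wpDl.
exists (eta + 1)^-1; first by rewrite invr_gt0.
move=> l l_ge0; rewrite -[(eta + 1)^-1]mul1r ler_pdivlMr// => le1.
rewrite [_ * _]mulrA; apply: convex_set_scale => //; first exact: mulr_ge0.
by apply: le_trans le1; rewrite ler_wpM2l// lerDl.
Qed.

(** * The Bouligand cone *)

Lemma bouligand_coneZ {R : realType} {n : nat} (S : set 'rV[R]_n) x (k : R) q :
  0 < k -> bouligand_cone S x (k *: q) -> bouligand_cone S x q.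
Proof.
move=> k_gt0 [t [z [t_gt0 [t_dec t0] Sz zx zq]]].
exists (fun i => k * t i), z; split => //.
- by move=> i; rewrite mulr_gt0.
- split; first by move=> i j ij; rewrite ler_pM2l// t_dec.
  by rewrite -(mulr0 k); apply: cvgMl_tmp.
- rewrite -[q](scalerK (lt0r_neq0 k_gt0)).
  rewrite (_ : (fun _ => _) = fun i => k^-1 *: ((t i)^-1 *: (z i - x))).
    exact: cvgZl_tmp.
  by apply/funext => i; rewrite scalerA invfM.
Qed.

Lemma bouligand_cone_ray {R : realType} {n : nat} (S : set 'rV[R]_n) x q
    (e : R) :
  0 < e -> (forall t, 0 <= t -> t <= e -> S (x + t *: q)) ->
  bouligand_cone S x q.
Proof.
move=> e_gt0 Sq.
have t_gt0 i : 0 < e / i.+1%:R by rewrite divr_gt0.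
have t0 : (fun i => e / i.+1%:R) @ \oo --> (0 : R).
  by rewrite -(mulr0 e); apply: cvgMl_tmp; exact: cvg_harmonic.
exists (fun i => e / i.+1%:R), (fun i => x + (e / i.+1%:R) *: q); split => //.
- split=> // i j ij.
  by rewrite ler_pM2l// lef_pV2 ?posrE// ler_nat.
- move=> i; apply: Sq; first exact/ltW/t_gt0.
  by rewrite ler_pdivrMr// ler_peMr ?ler1n// ltW.
- rewrite -[X in _ --> X]addr0; apply: cvgD; first exact: cvg_cst.
  by rewrite -(scale0r q); apply: cvgZr_tmp.
- rewrite (_ : (fun _ => _) = fun=> q); first exact: cvg_cst.
  by apply/funext => i; rewrite addrAC subrr add0r scalerK// gt_eqF.
Qed.

(** The times [h] come from a sequence defining the tangent vector [q]. Along it both [y] and the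
    points [z] of [S] move linearly up to o(h), with velocities ['D_1 y t] and [q]. *)
Lemma bouligand_step {R : realType} {n : nat} (S : set 'rV[R]_n)
    (y : R -> 'rV[R]_n) (t eps : R) (s q : 'rV[R]_n) :
  derivable y t 1 -> bouligand_cone S s q -> 0 < eps ->
  exists h z, [/\ 0 < h < eps, S z, `|z - s| < eps &
    `|y (t + h) - z| <= `|y t - s| + h * (`|'D_1 y t - q| + eps)].
Proof.
move=> dy [tt [z [t_gt0 [_ t0] Sz zs zq]]] eps_gt0.
have e2 : 0 < eps / 2 by rewrite divr_gt0.
have quot :
    (fun i => (tt i)^-1 *: (y (tt i *: 1 + t) - y t)) @ \oo --> 'D_1 y t.
  apply: (cvg_comp tt (fun h => h^-1 *: (y (h *: 1 + t) - y t))) dy.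
  move=> P /= /nbhs_ballP[e /= e_gt0 eP].
  near=> i; apply: eP; last by rewrite gt_eqF.
  by rewrite /ball/=; near: i; move/cvgrPdist_lt : t0; exact.
near \oo => i; exists (tt i), (z i); split => //.
- by rewrite t_gt0/=; near: i; exact: (cvgr_lt 0).
- near: i; move/cvgrPdist_lt : zs => /(_ _ eps_gt0); apply: filterS => i.
  by rewrite distrC.
have h1 : `|'D_1 y t - (tt i)^-1 *: (y (tt i *: 1 + t) - y t)| < eps / 2.
  by near: i; move/cvgrPdist_lt : quot; exact.
have h2 : `|q - (tt i)^-1 *: (z i - s)| < eps / 2.
  by near: i; move/cvgrPdist_lt : zq; exact.
have ti := t_gt0 i.
(* The errors of the two difference quotients, each smaller than [eps / 2] in norm. *)
pose a := 'D_1 y t - (tt i)^-1 *: (y (tt i *: 1 + t) - y t).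
pose b := q - (tt i)^-1 *: (z i - s).
have -> : y (t + tt i) - z i = (y t - s) + tt i *: (('D_1 y t - q) - (a - b)).
  have -> : ('D_1 y t - q) - (a - b) = ('D_1 y t - a) - (q - b).
    by rewrite !opprB addrACA [RHS]addrACA; congr (_ + _); exact: addrC.
  rewrite /a /b !subKr -scalerBr scalerKV ?lt0r_neq0//.
  rewrite [_ *: 1]mulr1 [tt i + t]addrC.
  by rewrite opprB addrACA [y t + _]addrCA subrr addr0 addKr.
apply: (le_trans (ler_normD _ _)); rewrite lerD2l normrZ gtr0_norm//.
rewrite ler_pM2l//; apply: (le_trans (ler_normB _ _)); rewrite lerD2l.
apply: (le_trans (ler_normB _ _)); rewrite ltW// [eps]splitr.
exact: ltrD.
Unshelve. all: by end_near. Qed.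

(** * Gronwall estimate and continuation in time *)

(** Let [m] be the supremum of the distance from [y] to [K] on a short interval. If [m > 0], the
    distance grows at rate at most [(c + 1) * m], so it stays at most [m / 2], a contradiction. *)
Lemma local_invariance {R : realType} {n : nat} (S : set 'rV[R]_n)
    (y : R -> 'rV[R]_n) (T t0 r c : R) (N : set R) :
  absolutely_continuous T y -> (@lebesgue_measure R).-negligible N ->
  0 <= c -> 0 < r -> 0 <= t0 -> t0 <= T -> S (y t0) ->
  compact (S `&` [set x | `|x - y t0| <= r]) ->
  (forall t, 0 <= t -> t <= T -> ~ N t -> `|y t - y t0| <= r ->
    derivable y t 1 /\ forall s, S s -> `|s - y t0| <= r ->
      exists2 q, bouligand_cone S s q & `|'D_1 y t - q| <= c * `|y t - s|) ->
  exists2 tau, 0 < tau &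
    forall t, t0 <= t -> t <= t0 + tau -> t <= T -> S (y t).
Proof.
move=> y_ac N0 c_ge0 r_gt0 t0_ge0 t0T Sy0 K_compact cone_N.
set K := S `&` _ in K_compact.
have Ky0 : K (y t0) by split => //=; rewrite subrr normr0 ltW.
have [p p_nearest] := nearest_point K K_compact (ex_intro _ _ Ky0).
pose phi t := `|y t - p (y t)|.
(* The distance to a set is 1-Lipschitz, so [phi] inherits absolute continuity from [y] although [p]
   may be discontinuous. *)
have phi_lip s t : `|phi t - phi s| <= `|y t - y s|.
  have le1 u v : phi u - phi v <= `|y u - y v|.
    rewrite lerBlDr; have [Kv _] := p_nearest (y v).
    by apply: le_trans (ler_distD (y v) _ _); exact: (p_nearest (y u)).2.
  by rewrite ler_norml le1 lerNl opprB distrC le1.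
have phi_ac : absolutely_continuous T (phi : R -> R).
  move=> e /y_ac[d d_gt0 dP]; exists d => // k a b ab_le ab_triv ab_d.
  by apply: le_lt_trans (dP k a b ab_le ab_triv ab_d); apply: ler_sum.
have r3 : 0 < r / 3 by rewrite divr_gt0.
have c1 : 0 < c + 1 by rewrite ltr_wpDl.
have [d d_gt0 y_cont] := absolutely_continuous_uniform _ y_ac r3.
(* The first bound keeps [y] within [r / 3] of [y t0], the second makes [(c + 1) * tau] at most
   1/2. *)
pose tau := Num.min (d / 2) ((c + 1)^-1 / 2).
have tau_gt0 : 0 < tau by rewrite lt_min !divr_gt0// invr_gt0.
exists tau => //.
pose J := [set t | [/\ t0 <= t, t <= t0 + tau & t <= T]].
have y_near t : J t -> `|y t - y t0| < r / 3.
  move=> [t0t tt tT]; apply: y_cont => //.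
  have : tau <= d / 2 by rewrite ge_min lexx.
  lra.
have phi_near t : J t -> phi t <= r / 3.
  move=> Jt; apply: ltW; apply: le_lt_trans (y_near t Jt).
  exact: (p_nearest _).2.
have J0 : J t0 by split => //; rewrite lerDl ltW.
have phi_sup : has_sup (phi @` J).
  split; first by exists (phi t0), t0.
  by exists (r / 3) => _ [t Jt <-]; exact: phi_near.
pose m := sup (phi @` J).
have phi_m t : J t -> phi t <= m.
  by move=> Jt; apply: ub_le_sup; [case: phi_sup|exists t].
have phi_r : m <= r / 3.
  by apply: ge_sup; [case: phi_sup|move=> _ [t Jt <-]; exact: phi_near].
suff m_le0 : m <= 0.
  move=> t t0t tt tT; have Jt : J t by [].
  have : phi t <= 0 by exact: le_trans (phi_m t Jt) m_le0.
  by rewrite normr_le0 subr_eq0 => /eqP ->; have [[]] := p_nearest (y t).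
rewrite leNgt; apply/negP => m_gt0.
have phi0 : phi t0 = 0.
  apply/eqP; rewrite eq_le normr_ge0 andbT.
  by have := (p_nearest (y t0)).2 _ Ky0; rewrite subrr normr0.
suff : m <= m / 2 by lra.
apply: ge_sup; [by case: phi_sup|move=> _ [t Jt <-]].
have [t0t tt tT] := Jt.
have : phi t - phi t0 <= ((c + 1) * m) * (t - t0).
  apply: (absolutely_continuous_increment_le T _ _ _ _ N) => //.
    by rewrite mulr_ge0// ltW.
  move=> u t0u ut Nu.
  have uT : u <= T by exact: le_trans (ltW ut) tT.
  have Ju : J u by split => //; exact: le_trans (ltW ut) tt.
  have [[Ss sr] s_min] := p_nearest (y u).
  have yu : `|y u - y t0| <= r.
    by apply: (le_trans (ltW (y_near u Ju))); lra.
  have [dyu coneu] := cone_N u (le_trans t0_ge0 t0u) uT Nu yu.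
  have [q Sq qle] := coneu _ Ss sr.
  (* The three bounds yield in turn [u + h <= t], the slope [c * m + m], and [z] in [K]. *)
  have e_gt0 : 0 < Num.min (t - u) (Num.min m (r / 3)).
    by rewrite !lt_min subr_gt0 ut m_gt0 r3.
  have [h [z [/andP[h_gt0]]]] := bouligand_step S y u _ _ q dyu Sq e_gt0.
  set e := Num.min _ _ => he Sz zs step.
  have [eu em er] : [/\ e <= t - u, e <= m & e <= r / 3].
    by split; rewrite /e !ge_min lexx ?orbT.
  exists h; split => //; first by lra.
  (* Three distances of at most [r / 3] add up: from [z] to [p (y u)], on to [y u], and on to
     [y t0]. *)
  have Kz : K z.
    split => //=; apply: (le_trans (ler_distD (p (y u)) _ _)).
    have := ler_distD (y u) (p (y u)) (y t0).
    have := y_near u Ju; have := phi_near u Ju.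
    rewrite /phi [`|p (y u) - y u|]distrC; lra.
  rewrite lerBlDl; apply: (le_trans ((p_nearest _).2 _ Kz)).
  apply: (le_trans step); rewrite lerD2l mulrC ler_wpM2r ?(ltW h_gt0)//.
  rewrite mulrDl mul1r lerD//; apply: (le_trans qle).
  by rewrite ler_wpM2l// phi_m.
rewrite phi0 subr0 => /le_trans; apply.
have : tau <= (c + 1)^-1 / 2 by rewrite ge_min lexx orbT.
move=> tau_c; have h1 : t - t0 <= (c + 1)^-1 / 2 by lra.
rewrite [(c + 1) * m]mulrC -mulrA ler_wpM2l ?(ltW m_gt0)//.
apply: (@le_trans _ _ ((c + 1) * ((c + 1)^-1 / 2))).
  by rewrite ler_wpM2l// ltW.
by rewrite mulrA divff ?mul1r ?lt0r_neq0.
Qed.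

(** Let [b] be the supremum of the times up to which [P] holds throughout. The limit hypothesis
    gives [P b] if [b > 0], and the step hypothesis would carry [P] beyond [b] if [b < T]. *)
Lemma real_induction {R : realType} (T : R) (P : set R) :
  P 0 ->
  (forall t, 0 < t -> t <= T -> (forall s, 0 <= s -> s < t -> P s) -> P t) ->
  (forall t, 0 <= t -> t < T -> P t ->
    exists2 tau, 0 < tau & forall s, t <= s -> s <= t + tau -> s <= T -> P s) ->
  forall t, 0 <= t -> t <= T -> P t.
Proof.
move=> P0 Plim Pstep u u_ge0 uT.
have T_ge0 : 0 <= T by exact: le_trans uT.
pose E := [set t | [/\ 0 <= t, t <= T & forall s, 0 <= s -> s <= t -> P s]].
have E0 : E 0 by split => // s s0 s0'; have -> : s = 0 by apply/le_anti/andP.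
have E_sup : has_sup E by split; [exists 0|exists T => t []].
pose b := sup E.
have b_ge0 : 0 <= b by apply: ub_le_sup; [case: E_sup|].
have bT : b <= T by apply: ge_sup; [exists 0|move=> t []].
have Pltb s : 0 <= s -> s < b -> P s.
  move=> s_ge0 sb; have bs : 0 < b - s by rewrite subr_gt0.
  have [t [_ _ tP]] := sup_adherent bs E_sup.
  by rewrite opprB addrC subrK => /ltW /tP; apply.
have Pb : P b.
  have [->//|b0] := eqVneq b 0.
  by apply: Plim => //; rewrite lt_neqAle eq_sym b0.
have Pleb s : 0 <= s -> s <= b -> P s.
  by move=> s_ge0; rewrite le_eqVlt => /predU1P[->//|]; exact: Pltb.
suff bT' : b = T by apply: Pleb => //; rewrite bT'.
apply/eqP; rewrite eq_le bT leNgt; apply/negP => b_lt.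
have [tau tau_gt0 Ptau] := Pstep b b_ge0 b_lt Pb.
have : E (Num.min (b + tau) T).
  split; rewrite ?le_min ?ge_min ?lexx ?orbT ?T_ge0 ?addr_ge0 ?(ltW tau_gt0)//.
  move=> s s_ge0; rewrite le_min => /andP[st sT].
  by have [/Pleb|/ltW bs] := leP s b; [apply|exact: Ptau].
move=> /(ub_le_sup (proj2 E_sup)); rewrite -/b leNgt lt_min b_lt andbT.
by rewrite ltrDl tau_gt0.
Qed.

(** * Lipschitz bounds uniform in the control *)

(** Compactness of [A] makes the local constants and radii at the points [(x0, a)] uniform in [a]. A
    single large [L] is the Lipschitz constant and, inverted, the radius, so finitely many such
    bounds can be met together. *)
Lemma locally_lipschitz_uniform {R : realType} {V W : normedModType R}
    {O : set V} {A : set W} {g : V * W -> R} {x0 : V} :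
  compact A -> O x0 -> locally_lipschitz_on (O `*` A) (g : _ -> R^o) ->
  \forall L \near +oo, forall x x' a, O x -> O x' -> A a ->
    `|x - x0| < L^-1 -> `|x' - x0| < L^-1 ->
    `|g (x, a) - g (x', a)| <= L * `|x - x'|.
Proof.
move=> A_compact Ox0 g_lip.
have /near_covering_withinP cover := (compact_near_coveringP A).1 A_compact.
suff : \forall L \near +oo, A `<=` (fun a => forall x x', O x -> O x' ->
    `|x - x0| < L^-1 -> `|x' - x0| < L^-1 ->
    `|g (x, a) - g (x', a)| <= L * `|x - x'|).
  by apply: filterS => L LA x x' a Ox Ox' Aa; exact: LA.
apply: cover => a Aa.
have [U [[B1 B2]/= [/nbhs_ballP[e /= e_gt0 eB1] B2a] BU] lipU] :=
  g_lip (x0, a) (conj Ox0 Aa).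
near=> a' L => Aa' x x' Ox Ox' xL x'L.
have L_gt0 : 0 < L by near: L; apply: nbhs_pinfty_gt; rewrite num_real.
have Le : L^-1 < e.
  rewrite invf_plt ?posrE//; near: L; apply: nbhs_pinfty_gt.
  by rewrite num_real.
have mem z : O z -> `|z - x0| < L^-1 -> ((O `*` A) `&` U) (z, a').
  move=> Oz zL; split => //; apply: BU; split => /=; last by near: a'.
  apply: eB1; rewrite -ball_normE/= distrC; exact: lt_trans zL Le.
have lipL : L.-lipschitz_((O `*` A) `&` U) (g : _ -> R^o).
  by near: L; exact: lipU.
have := lipL ((x, a'), (x', a')) (conj (mem x Ox xL) (mem x' Ox' x'L)).
(* The two points share the coordinate [a'], so the maximum norm of their difference is that of
   [x - x']. *)
rewrite /= [X in L * X](_ : _ = `|x - x'|) //.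
by rewrite prod_normE/= subrr normr0 max_l.
Unshelve. all: by end_near. Qed.

(** * Trajectories with constant control and velocity *)

Lemma measurable_control_cst {R : realType} {m : nat} (A : set 'rV[R]_m)
    (T : R) (a : 'rV[R]_m) : A a -> measurable_control A T (fun=> a).
Proof.
move=> Aa; split => // U _; exists (`[0, T]%classic `&` (fun=> a) @^-1` U).
  have [Ua|nUa] := pselect (U a).
    by rewrite (_ : _ @^-1` U = setT) ?setIT//; apply/seteqP; split.
  by rewrite (_ : _ @^-1` U = set0) ?setI0//; apply/seteqP; split.
by exists set0; [exact: negligible_set0|rewrite setU0].
Qed.

Lemma absolutely_continuous_line {R : realType} {V : normedModType R} (T : R)
    (x v : V) : absolutely_continuous T (fun t : R => x + t *: v).
Proof.
move=> e e_gt0; have v1 : 0 < `|v| + 1 by rewrite ltr_wpDl.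
exists (e / (`|v| + 1)); first by rewrite divr_gt0.
move=> k a b ab _; rewrite ltr_pdivlMr// => sum_lt.
apply: le_lt_trans sum_lt; rewrite mulr_suml; apply: ler_sum => i _.
have [_ abi _] := ab i.
rewrite [_ + _ *: v - _](_ : _ = (b i - a i) *: v).
  by rewrite normrZ ger0_norm ?subr_ge0// ler_wpM2l ?subr_ge0// lerDl.
by rewrite opprD addrACA subrr add0r scalerBl.
Qed.

Lemma is_derive_line {R : realType} {V : normedModType R} (x v : V) (t : R) :
  is_derive t 1 (fun t : R => x + t *: v) v.
Proof.
have line_cvg : h^-1 *: (((fun t : R => x + t *: v) \o shift t) (h *: 1)
    - (x + t *: v)) @[h --> 0^'] --> v.
  apply: cvg_near_cst; near=> h.
  have h0 : h != 0 by near: h; exact: nbhs_dnbhs_neq.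
  rewrite /= [h *: 1]mulr1 opprD addrACA subrr add0r -scalerBl addrK.
  by rewrite scalerA mulVf// scale1r.
apply: DeriveDef; first by apply/cvg_ex; exists v.
exact/cvg_lim.
Unshelve. all: by end_near. Qed.

(** The value 3/4 serves because the product of two such ratios is at least 9/16, hence above
    1/2. *)
Lemma ratio_ge {R : realType} (p q : R) :
  q != 0 -> `|p - q| <= `|q| / 4 -> 3 / 4 <= p / q.
Proof.
move=> q0 pq; have : `|p / q - 1| <= 1 / 4.
  rewrite -[X in _ - X](divff q0) -mulrBl normrM normfV.
  by rewrite ler_pdivrMr ?normr_gt0// mulrC mulrA mulr1.
by rewrite ler_norml => /andP[+ _]; lra.
Qed.

(** For [z] near [x], some [u] in [D z] and the value [g (z, a)] each differ from [d] and [g (x, a)]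
    by at most a quarter in relative terms. Hence [g (z, a) * u] is at least half of [g (x, a) * d]
    in ratio, and shrinking [u] towards 0 within [D z] attains the half exactly. *)
Lemma near_half_value {R : realType} {V W : normedModType R} {O : set V}
    {A : set W} {g : V * W -> R} {D : V -> set R} {x : V} {a : W} {d : R} :
  compact A -> open O -> O x -> A a ->
  locally_lipschitz_on (O `*` A) (g : _ -> R^o) ->
  (forall x, convex_set (D x : set (convex_lmodType R^o))) ->
  lsc_multifunction (D : V -> set R^o) -> (forall x, D x 0) -> D x d ->
  \forall z \near x, exists2 d', D z d' & g (z, a) * d' = 2^-1 * (g (x, a) * d).
Proof.
move=> A_compact O_open Ox Aa g_lip D_convex D_lsc D0 Dd.
have [gd0|gd0] := eqVneq (g (x, a) * d) 0.
  by near=> z; exists 0 => //; rewrite gd0 !mulr0.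
have [g0 d0] : g (x, a) != 0 /\ d != 0.
  by move: gd0; rewrite mulf_eq0 negb_or => /andP.
have d4 : 0 < `|d| / 4 by rewrite divr_gt0 ?normr_gt0.
have [delta delta_gt0 Ddelta] := D_lsc x _ d4.
have := locally_lipschitz_uniform A_compact Ox g_lip.
move=> /pinfty_ex_gt0[L L_gt0 gL].
have Li : 0 < L^-1 by rewrite invr_gt0.
have gL4 : 0 < `|g (x, a)| / 4 / L by rewrite !divr_gt0 ?normr_gt0.
have near_norm e : 0 < e -> \forall z \near x, `|z - x| < e.
  move=> e_gt0; apply/nbhs_ballP; exists e => // w.
  by rewrite -ball_normE/= distrC.
near=> z.
have Oz : O z by near: z; exact: open_nbhs_nbhs.
have zdelta : cball delta (z - x) by apply: ltW; near: z; exact: near_norm.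
have [u Du [v v_le duv]] := Ddelta z zdelta d Dd.
have g_le : `|g (z, a) - g (x, a)| <= `|g (x, a)| / 4.
  have zL : `|z - x| < L^-1 by near: z; exact: near_norm.
  apply: (le_trans (gL z x a Oz Ox Aa zL _)); first by rewrite subrr normr0.
  by rewrite mulrC -ler_pdivlMr// ltW//; near: z; exact: near_norm.
have u_le : `|u - d| <= `|d| / 4.
  by rewrite (_ : u - d = - v) ?normrN// -duv opprD addrA subrr add0r.
pose s := g (z, a) / g (x, a); pose r := u / d.
have s34 : 3 / 4 <= s by exact: ratio_ge.
have r34 : 3 / 4 <= r by exact: ratio_ge.
have sr : 2^-1 <= s * r by nra.
have sr_gt0 : 0 < s * r by lra.
(* This factor turns the ratio [s * r] into 1/2; it is at most 1, so the point stays in [D z]. *)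
exists (2^-1 / (s * r) * u).
  apply: convex_set_scale => //; first by rewrite divr_ge0// ltW.
  by rewrite ler_pdivrMr// mul1r.
have : s * r != 0 by exact: lt0r_neq0.
rewrite !mulf_eq0 !negb_or !invr_eq0 => /andP[/andP[gz0 _] /andP[u0 _]].
rewrite /s /r; field.
by rewrite g0 gz0 u0 d0.
Unshelve. all: by end_near. Qed.

Theorem theorem2 (R : realType) (n m : nat) (n_gt0 : (0 < n)%N)
    (O : set 'rV[R]_n) (S : set 'rV[R]_n) (A : set 'rV[R]_m)
    (g : 'I_n -> 'rV[R]_n * 'rV[R]_m -> R)
    (D : 'I_n -> 'rV[R]_n -> set R)
    (F : 'rV[R]_n -> 'rV[R]_m -> set 'rV[R]_n)
    (O_open : open O) (S_closed : relatively_closed O S) (A_compact : compact A)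
    (F_def : forall x a, O x -> A a ->
      F x a = prod_set (fun i => [set g i (x, a) * d | d in D i x]))
    (g_lip : forall i, locally_lipschitz_on (O `*` A) (g i))
    (D_measurable : forall i, measurable_multifunction (D i))
    (D_bounded : forall i, locally_bounded_multifunction (D i))
    (D_closed : forall i x, closed (D i x))
    (D_convex : forall i x, convex_set (D i x : set (convex_lmodType R^o)))
    (D_lsc : forall i, lsc_multifunction (D i))
    (D_0 : forall i x, D i x 0)
    (D_cone : forall i x x',
      cone (D i x : set R^o) = cone (D i x' : set R^o)) :
  strongly_invariant O A F S <->
  (forall x, S x -> \bigcup_(a in A) F x a `<=` bouligand_cone S x).
Proof.
have [C C_closed S_CO] := S_closed.
have SO x : S x -> O x by rewrite S_CO => -[].
split=> [S_inv x Sx v [a Aa Fv]|S_tangent T T_gt0 y].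

  (* Strong invariance implies tangency *)
  have Ox := SO x Sx.
  pose w := 2^-1 *: v.
  have near_F : \forall z \near x, O z /\ F z a w.
    have near_w : \forall z \near x, forall i,
        exists2 d, D i z d & g i (z, a) * d = w ord0 i.
      apply: (filter_forall (F := nbhs x)) => i.
      move: Fv; rewrite F_def// => /(_ i)[d Dd gd].
      rewrite /w mxE -gd.
      exact: (near_half_value A_compact O_open Ox Aa (g_lip i) (D_convex i)
        (D_lsc i) (D_0 i) Dd).
    near=> z; have Oz : O z by near: z; exact: open_nbhs_nbhs.
    split => //; rewrite F_def// => i /=.
    by move: i; near: z.
  have [e /= e_gt0 eF] := (nbhs_ballP _ _).1 near_F.
  have w1 : 0 < `|w| + 1 by rewrite ltr_wpDl.
  (* The segment then has length below [e]; adding 1 to the norm avoids dividing by 0. *)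
  pose T := e / (`|w| + 1) / 2.
  have T_gt0 : 0 < T by rewrite !divr_gt0.
  have ray t : 0 <= t -> t <= T -> O (x + t *: w) /\ F (x + t *: w) a w.
    move=> t_ge0 tT; apply: eF; rewrite -ball_normE/= opprD addrA subrr add0r.
    rewrite normrN normrZ ger0_norm//.
    have : T * (`|w| + 1) = e / 2.
      by rewrite /T mulrAC divfK ?lt0r_neq0.
    have := normr_ge0 w; nra.
  apply: (bouligand_coneZ S x 2^-1 v) => //.
  apply: (bouligand_cone_ray S x w T) => // t t_ge0 tT.
  apply: (S_inv T T_gt0 (fun t => x + t *: w)); last by rewrite in_itv/= t_ge0.
  - split.
        by move=> u; rewrite in_itv/= => /andP[u0 uT]; exact: (ray u u0 uT).1.
      exact: absolutely_continuous_line.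
    exists (fun=> a); first exact: measurable_control_cst.
    apply: aeW => u; rewrite in_itv/= => /andP[u0 uT].
    have dw := is_derive_line x w u.
    split; first exact: ex_derive.
    by rewrite derive_val; exact: (ray u u0 uT).2.
  - by rewrite scale0r addr0.

(* Tangency implies strong invariance *)
move=> [yO y_ac [alpha [alphaA _] y_ae]] Sy0 t.
rewrite in_itv/= => /andP[+ +]; move: t.
apply: (real_induction T (fun t => S (y t))) => //.
  (* Limit stage: if [y t] were outside the closed set [C], so would be [y s] for some earlier [s]
     close to [t]. *)
  move=> t t_gt0 tT St; rewrite S_CO; split; last first.
    by apply: yO; rewrite in_itv/= tT ltW.
  apply: contrapT => nC.
  have /nbhs_ballP[e /= e_gt0 eC] : nbhs (y t) (~` C).
    by apply: open_nbhs_nbhs; split => //; exact: closed_openC.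
  have [d d_gt0 y_cont] := absolutely_continuous_uniform _ y_ac e_gt0.
  pose s := Num.max 0 (t - d / 2).
  have s_ge0 : 0 <= s by rewrite le_max lexx.
  have st : s < t by rewrite gt_max t_gt0/=; lra.
  have : S (y s) by exact: St.
  rewrite S_CO => -[+ _]; apply: (eC (y s)); rewrite -ball_normE/=.
  apply: y_cont => //; first exact: ltW.
  have : t - d / 2 <= s by rewrite le_max lexx orbT.
  lra.
move=> t0 t0_ge0 t0T Sx0.
have Ox0 := SO _ Sx0.
pose N := ~` [set t : R | t \in `[0, T] ->
  derivable y t 1 /\ F (y t) (alpha t) ('D_1 y t)].
have near_L : \forall L \near +oo, forall i x x' a, O x -> O x' -> A a ->
    `|x - y t0| < L^-1 -> `|x' - y t0| < L^-1 ->
    `|g i (x, a) - g i (x', a)| <= L * `|x - x'|.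
  apply: (filter_forall (F := +oo)) => i.
  exact: (locally_lipschitz_uniform A_compact Ox0 (g_lip i)).
have [L L_gt0 gL] := pinfty_ex_gt0 near_L.
have x01 : 0 < `|y t0| + 1 by rewrite ltr_wpDl.
have near_M : \forall M \near +oo, forall i x d,
    `|x| <= `|y t0| + 1 -> D i x d -> `|d| <= M.
  apply: (filter_forall (F := +oo)) => i.
  near=> M => x d xr Dd.
  have DM : globally (\bigcup_(z in cball (`|y t0| + 1)) D i z)
      [set d | `|d| <= M].
    by near: M; exact: D_bounded.
  by apply: DM; exists x.
have [M M_gt0 DM] := pinfty_ex_gt0 near_M.
have [rO /= rO_gt0 ballO] :=
  (nbhs_ballP _ _).1 (open_nbhs_nbhs (conj O_open Ox0)).
(* The three bounds keep the closed ball of radius [r] around [y t0] inside [O], where [L] is a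
   Lipschitz constant, and where [M] bounds every [D i]. *)
pose r := Num.min (rO / 2) (Num.min (L^-1 / 2) 1).
have r_gt0 : 0 < r by rewrite !lt_min !divr_gt0// ?invr_gt0//=.
have [r_rO rL r1] : [/\ r < rO, r < L^-1 & r <= 1].
  have : 0 < L^-1 by rewrite invr_gt0.
  by split; rewrite /r ?gt_min ?ge_min ?lexx ?orbT//;
    apply/orP; [left|right; apply/orP; left]; lra.
have rO' x : `|x - y t0| <= r -> O x.
  move=> xr; apply: ballO; rewrite -ball_normE/= distrC.
  exact: le_lt_trans r_rO.
have LM_ge0 : 0 <= L * M by rewrite mulr_ge0// ltW.
apply: (local_invariance S y T t0 r (L * M) N) => //.
- exact: ltW.
(* The ball lies in [O], so there [S] coincides with the closed set [C]. *)
- rewrite (_ : _ `&` _ = C `&` [set x | `|x - y t0| <= r]); last first.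
    apply/seteqP; split => x [] /=; first by rewrite S_CO => -[].
    by move=> Cx xr; split => //; rewrite S_CO; split => //; exact: rO'.
  apply: bounded_closed_compact.
    exists (`|y t0| + r); split; first by rewrite num_real.
    move=> B rB x [_ /= xr]; apply: (le_trans _ (ltW rB)).
    by rewrite -[x](subrK (y t0)) addrC (le_trans (ler_normD _ _))// lerD2l.
  apply: closedI => //.
  rewrite (_ : [set _ | _] = closed_ball (y t0) r).
    exact: closed_ball_closed.
  by rewrite closed_ballE//; apply/seteqP; split => x /=; rewrite distrC.
- move=> t t_ge0 tT /contrapT/=.
  rewrite in_itv/= t_ge0 tT => /(_ isT)[dy Fy] yr.
  have tT' : t \in `[0, T] by rewrite in_itv/= t_ge0.
  have Oy := yO t tT'; have Aa := alphaA t tT'.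
  split => // s Ss sr; have Os := SO s Ss.
  move: Fy; rewrite F_def// => Fy.
  have /choice[d dP] : forall i, exists d, D i (y t) d /\
      g i (y t, alpha t) * d = 'D_1 y t ord0 i.
    by move=> i; have [d ? ?] := Fy i; exists d.
  pose q := \row_i (g i (s, alpha t) * d i).
  exists q.
    (* Constancy of the cone puts [d i] in the cone of [D i s]. One small [l] works for all of the
       finitely many coordinates, and the tangent cone absorbs it. *)
    have near_l : \forall l \near 0^'+, forall i, D i s (l * d i).
      apply: (filter_forall (F := 0^'+)) => i.
      have [|l0 l0_gt0 Dl] := cone_scale (D i s) (d i) (D_convex i s) (D_0 i s).
        rewrite (D_cone i s (y t)); exists 1; first exact: ler01.
        by exists (d i); [exact: (dP i).1|rewrite scale1r].
      near=> l; apply: Dl; first by near: l; exact: nbhs_right_ge.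
      by near: l; exact: nbhs_right_le.
    have [l [Dl l_gt0]] := filter_ex (filterI near_l (nbhs_right_gt 0)).
    apply: (bouligand_coneZ S s l q) => //; apply: S_tangent => //.
    exists (alpha t) => //; rewrite F_def// => i /=.
    by exists (l * d i); [exact: Dl|rewrite !mxE mulrCA].
  (* Each coordinate is an increment of [g i], at most [L] times the distance from [y t] to [s],
     multiplied by [d i], which [M] bounds. *)
  apply: row_norm_le => [|i]; first by rewrite mulr_ge0.
  rewrite !mxE -(dP i).2 -mulrBl normrM mulrAC ler_pM//.
    by apply: gL => //; exact: le_lt_trans rL.
  apply: (DM i (y t)) (dP i).1.
  rewrite -[y t](subrK (y t0)) addrC (le_trans (ler_normD _ _))// lerD2l.
  exact: le_trans yr r1.
Unshelve. all: by end_near. Qed.
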